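(* Let $k\ge2$ and let $X$ be a $G$-space. (1) $X$ is contractible if and only if $\mathrm{TC}_{k,G}^{\#}(X)=\mathrm{TC}_{k,G}^{\#,*}(X)=1$. (2) In general, $\mathrm{TC}_{k,G}^{\#}(X)\le\mathrm{TC}_{k,G}(X)\le\mathrm{TC}_{k,G}^{*}(X)$ and $\mathrm{TC}_k(X)\le\mathrm{TC}_{k,G}^{\#}(X)\le\mathrm{TC}_{k,G}^{\#,*}(X)\le\mathrm{TC}_{k,G}^{*}(X)$. (3) If $G$ acts trivially on $X$, then $\mathrm{TC}_k(X)=\mathrm{TC}_{k,G}(X)=\mathrm{TC}_{k,G}^{\#}(X)=\mathrm{TC}_{k,G}^{\#,*}(X)=\mathrm{TC}_{k,G}^{*}(X)$. (4) If $H$ is a subgroup of $G$, then $\mathrm{TC}_{k,H}^{\#}(X)\le\mathrm{TC}_{k,G}^{\#}(X)$ and $\mathrm{TC}_{k,H}^{\#,*}(X)\le\mathrm{TC}_{k,G}^{\#,*}(X)$. In particular, if $Y$ is another $G$-space, then $\mathrm{TC}_{k,G}^{\#}(X\times Y)\le\mathrm{TC}_{k,G\times G}^{\#}(X\times Y)$ and $\mathrm{TC}_{k,G}^{\#,*}(X\times Y)\le\mathrm{TC}_{k,G\times G}^{\#,*}(X\times Y)$, where $G$ acts on $X\times Y$ diagonally and $G\times G$ acts on $X\times Y$ componentwise.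
   Context: $X^I$ is the space of paths $[0,1]\to X$ with the compact-open topology and $G$-action $(g\alpha)(t)=g(\alpha(t))$; $e_{k,X}\colon X^I\to X^k$ is $e_{k,X}(\alpha)=\left(\alpha(0),\alpha(\tfrac1{k-1}),\dots,\alpha(\tfrac{k-2}{k-1}),\alpha(1)\right)$. Each of the following is the smallest $n$ for which $X^k$ has an open cover $\{U_1,\dots,U_n\}$ with continuous sections $s_i\colon U_i\to X^I$ of $e_{k,X}$ satisfying the indicated conditions ($\infty$ if no such $n$ exists): - $\mathrm{TC}_k(X)$: no further condition; - $\mathrm{TC}_{k,G}^{\#}(X)$: each $U_i$ is invariant under the diagonal $G$-action on $X^k$; - $\mathrm{TC}_{k,G}(X)$: each $U_i$ is invariant under the diagonal $G$-action and each $s_i$ is a $G$-map; - $\mathrm{TC}_{k,G}^{\#,*}(X)$: each $U_i$ is invariant under the componentwise $G^k$-action on $X^k$; - $\mathrm{TC}_{k,G}^{*}(X)$: each $U_i$ is invariant under the componentwise $G^k$-action and each $s_i$ is a $G$-map for the diagonal $G$-action on $U_i$. *)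

(* Defs.v *)
From HB Require Import structures.
From mathcomp Require Import all_boot all_order all_algebra.
From mathcomp Require Import all_classical all_reals.
From mathcomp Require Import ereal topology normedtype.

Set Implicit Arguments.
Unset Strict Implicit.
Unset Printing Implicit Defensive.

Import Order.TTheory GRing.Theory Num.Theory.
Import numFieldNormedType.Exports.

Local Open Scope classical_set_scope.
Local Open Scope ring_scope.

Section PairContinuity.
Variables T U V W : topologicalType.

Lemma pair_continuous (f : T -> U) (g : T -> V) :
  continuous f -> continuous g -> continuous (fun t => (f t, g t)).
Proof. by move=> fc gc t; apply: cvg_pair; [exact: fc|exact: gc]. Qed.

Lemma continuous_comp2 (h : U * V -> W) (f : T -> U) (g : T -> V) :
  continuous h -> continuous f -> continuous g ->
  continuous (fun t => h (f t, g t)).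
Proof.
move=> hc fc gc t; apply: (@continuous_comp _ _ _ (fun t => (f t, g t)) h).
  exact: pair_continuous.
exact: hc.
Qed.

End PairContinuity.

Lemma fst_continuous (T U : topologicalType) : continuous (@fst T U).
Proof. by move=> p; exact: cvg_fst. Qed.

Lemma snd_continuous (T U : topologicalType) : continuous (@snd T U).
Proof. by move=> p; exact: cvg_snd. Qed.

Lemma comp_continuous (T U V : topologicalType) (f : T -> U) (g : U -> V) :
  continuous f -> continuous g -> continuous (fun t => g (f t)).
Proof. by move=> fc gc t; apply: continuous_comp; [exact: fc|exact: gc]. Qed.

HB.mixin Record isTopologicalGroup G & Group G & Topological G := {
  mulg_continuous : continuous (fun p : G * G => (p.1 * p.2)%g);
  invg_continuous : continuous (fun g : G => g^-1%g)
}.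

#[short(type="topologicalGroupType")]
HB.structure Definition TopologicalGroup :=
  {G of isTopologicalGroup G & Group G & Topological G}.

Section ProductGroup.
Variables G H : topologicalGroupType.

Fact pair_mulg_continuous :
  continuous (fun p : (G * H) * (G * H) => (p.1 * p.2)%g).
Proof.
have c1 := @fst_continuous (G * H)%type (G * H)%type.
have c2 := @snd_continuous (G * H)%type (G * H)%type.
apply: pair_continuous => /=.
- by apply: (continuous_comp2 (@mulg_continuous G));
    apply: comp_continuous; try exact: fst_continuous.
- by apply: (continuous_comp2 (@mulg_continuous H));
    apply: comp_continuous; try exact: snd_continuous.
Qed.

Fact pair_invg_continuous : continuous (fun p : G * H => p^-1%g).
Proof.
apply: pair_continuous => /=.
- by apply: (comp_continuous _ (@invg_continuous G)); exact: fst_continuous.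
- by apply: (comp_continuous _ (@invg_continuous H)); exact: snd_continuous.
Qed.

HB.instance Definition _ := isTopologicalGroup.Build (G * H)%type
  pair_mulg_continuous pair_invg_continuous.

End ProductGroup.

Record subgroup (G : groupType) := Subgroup {
  subgroup_set : set G;
  subgroup_group_closed : group_closed (fun g => g \in subgroup_set)
}.

Definition subgroup_type (G : groupType) (H : subgroup G) : Type :=
  set_type (subgroup_set H).
Coercion subgroup_type : subgroup >-> Sortclass.

Section SubgroupType.
Variables (G : topologicalGroupType) (H : subgroup G).

HB.instance Definition _ := SubChoice.on (subgroup_type H).
HB.instance Definition _ := SubChoice_isSubGroup.Build G _
  (subgroup_type H) (subgroup_group_closed H).
HB.instance Definition _ :=
  Topological.copy (subgroup_type H) (set_type (subgroup_set H)).

Fact subgroup_val_continuous : continuous (val : subgroup_type H -> G).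
Proof. exact: (@initial_continuous _ G (val : subgroup_type H -> G)). Qed.

Fact subgroup_mulg_continuous :
  continuous (fun p : subgroup_type H * subgroup_type H => (p.1 * p.2)%g).
Proof.
apply: (@continuous_comp_initial _ _ G (val : subgroup_type H -> G)).
rewrite (_ : _ \o _ = fun p : subgroup_type H * subgroup_type H =>
  (val p.1 * val p.2)%g); last by apply/funext => p; exact: gmulfM.
apply: (continuous_comp2 (@mulg_continuous G)).
- exact: (comp_continuous (@fst_continuous _ _) subgroup_val_continuous).
- exact: (comp_continuous (@snd_continuous _ _) subgroup_val_continuous).
Qed.

Fact subgroup_invg_continuous :
  continuous (fun g : subgroup_type H => g^-1%g).
Proof.
apply: (@continuous_comp_initial _ _ G (val : subgroup_type H -> G)).
rewrite (_ : _ \o _ = fun g : subgroup_type H => ((val g)^-1)%g); last first.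
  by apply/funext => g; exact: gmulfV.
exact: (comp_continuous subgroup_val_continuous (@invg_continuous G)).
Qed.

HB.instance Definition _ := isTopologicalGroup.Build (subgroup_type H)
  subgroup_mulg_continuous subgroup_invg_continuous.

End SubgroupType.

Record gaction (G : topologicalGroupType) (X : topologicalType) := GAction {
  gact :> G -> X -> X;
  gact1 : forall x, gact 1%g x = x;
  gactM : forall g h x, gact (g * h)%g x = gact g (gact h x);
  gact_continuous : continuous (fun p : G * X => gact p.1 p.2)
}.

Definition trivial_action (G : topologicalGroupType) (X : topologicalType)
  (a : gaction G X) := forall g x, a g x = x.

Section Restriction.
Variables (G : topologicalGroupType) (X : topologicalType) (a : gaction G X).
Variable H : subgroup G.

Definition res_act (h : subgroup_type H) (x : X) : X := a (val h) x.

Fact res_act1 x : res_act 1%g x = x.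
Proof. by rewrite /res_act gmulf1 gact1. Qed.

Fact res_actM g h x : res_act (g * h)%g x = res_act g (res_act h x).
Proof. by rewrite /res_act gmulfM gactM. Qed.

Fact res_act_continuous :
  continuous (fun p : subgroup_type H * X => res_act p.1 p.2).
Proof.
apply: (continuous_comp2 (@gact_continuous _ _ a)).
- by apply: comp_continuous; [exact: fst_continuous|
                              exact: subgroup_val_continuous].
- exact: snd_continuous.
Qed.

Definition gaction_restrict : gaction H X :=
  GAction res_act1 res_actM res_act_continuous.

End Restriction.

Section ComponentwiseAction.
Variables (G H : topologicalGroupType) (X Y : topologicalType).
Variables (a : gaction G X) (b : gaction H Y).

Definition prod_act (g : G * H) (p : X * Y) : X * Y := (a g.1 p.1, b g.2 p.2).

Fact prod_act1 p : prod_act 1%g p = p.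
Proof. by case: p => x y; rewrite /prod_act /= !gact1. Qed.

Fact prod_actM g h p : prod_act (g * h)%g p = prod_act g (prod_act h p).
Proof. by rewrite /prod_act /= !gactM. Qed.

Fact prod_act_continuous :
  continuous (fun q : (G * H) * (X * Y) => prod_act q.1 q.2).
Proof.
have c1 := @fst_continuous (G * H)%type (X * Y)%type.
have c2 := @snd_continuous (G * H)%type (X * Y)%type.
apply: pair_continuous => /=.
- by apply: (continuous_comp2 (@gact_continuous _ _ a));
    apply: comp_continuous; try exact: fst_continuous.
- by apply: (continuous_comp2 (@gact_continuous _ _ b));
    apply: comp_continuous; try exact: snd_continuous.
Qed.

Definition gaction_prod : gaction (G * H)%type (X * Y)%type :=
  GAction prod_act1 prod_actM prod_act_continuous.

End ComponentwiseAction.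

Section DiagonalAction.
Variables (G : topologicalGroupType) (X Y : topologicalType).
Variables (a : gaction G X) (b : gaction G Y).

Definition diag_act (g : G) (p : X * Y) : X * Y := (a g p.1, b g p.2).

Fact diag_act1 p : diag_act 1%g p = p.
Proof. by case: p => x y; rewrite /diag_act /= !gact1. Qed.

Fact diag_actM g h p : diag_act (g * h)%g p = diag_act g (diag_act h p).
Proof. by rewrite /diag_act /= !gactM. Qed.

Fact diag_act_continuous :
  continuous (fun q : G * (X * Y) => diag_act q.1 q.2).
Proof.
have c2 := @snd_continuous G (X * Y)%type.
apply: pair_continuous => /=.
- apply: (continuous_comp2 (@gact_continuous _ _ a)).
    exact: fst_continuous.
  by apply: comp_continuous => //; exact: fst_continuous.
- apply: (continuous_comp2 (@gact_continuous _ _ b)).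
    exact: fst_continuous.
  by apply: comp_continuous => //; exact: snd_continuous.
Qed.

Definition gaction_diag : gaction G (X * Y)%type :=
  GAction diag_act1 diag_actM diag_act_continuous.

End DiagonalAction.

Notation unit_interval R := (set_type `[0 : R, 1]%classic).

Definition path_space (R : realType) (X : topologicalType) : Type :=
  continuousType (unit_interval R) X.

HB.instance Definition _ (R : realType) (X : topologicalType) :=
  Choice.on (path_space R X).
HB.instance Definition _ (R : realType) (X : topologicalType) :=
  Topological.copy (path_space R X)
    (initial_topology
      (fun f : path_space R X => f : {compact-open, unit_interval R -> X})).

Section PathAction.
Variables (R : realType) (G : topologicalGroupType) (X : topologicalType).
Variable a : gaction G X.

Fact path_act_continuous (g : G) (f : path_space R X) :
  continuous (fun t : unit_interval R => a g (f t)).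
Proof.
apply: (continuous_comp2 (@gact_continuous _ _ a)).
  exact: cst_continuous.
exact: (@cts_fun _ _ (f : continuousType (unit_interval R) X)).
Qed.

Definition path_act (g : G) (f : path_space R X) : path_space R X :=
  mkcts (@path_act_continuous g f).

End PathAction.

Notation power X k := {ptws 'I_k -> X}.

Section PowerActions.
Variables (k : nat) (G : topologicalGroupType) (X : topologicalType).
Variable a : gaction G X.

Definition diagonal_act (g : G) (x : power X k) : power X k :=
  fun i => a g (x i).

Definition componentwise_act (g : 'I_k -> G) (x : power X k) : power X k :=
  fun i => a (g i) (x i).

End PowerActions.

Definition invariant_under (S T : Type) (act : S -> T -> T) (U : set T) :=
  forall g x, U x -> U (act g x).

Definition contractible (R : realType) (X : topologicalType) :=
  exists (x0 : X) (h : X * unit_interval R -> X), continuous h /\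
    forall (x : X) (t : unit_interval R),
      (val t = 0 -> h (x, t) = x) /\ (val t = 1 -> h (x, t) = x0).

Section TopologicalComplexity.
Variables (R : realType) (k : nat) (X : topologicalType).

Fact node_subproof (j : 'I_k) :
  (j%:R / k.-1%:R : R) \in `[0 : R, 1]%classic.
Proof.
rewrite inE /= in_itv /= divr_ge0 //=.
have jk : (j <= k.-1)%N by case: k j => [[]//|n j]; rewrite -ltnS.
case: (posnP k.-1) => [->|k0]; first by rewrite invr0 mulr0.
by rewrite ler_pdivrMr ?ltr0n// mul1r ler_nat.
Qed.

Definition node (j : 'I_k) : unit_interval R :=
  exist (fun t : R => t \in `[0 : R, 1]%classic) _ (node_subproof j).

Definition endpoints (f : path_space R X) : power X k := fun j => f (node j).

(* A section over U is a total function continuous on U, with junk values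
   outside U. No section is lost: for 0 < k, either X^k is empty or X^I is
   inhabited by a constant path. *)
Definition sectional_cover
    (C : set (power X k) -> (power X k -> path_space R X) -> Prop) (n : nat) :=
  exists (U : 'I_n -> set (power X k))
         (s : 'I_n -> power X k -> path_space R X),
    [/\ forall i, open (U i),
        \bigcup_i U i = setT,
        forall i, {within U i, continuous (s i)},
        forall i x, U i x -> endpoints (s i x) = x &
        forall i, C (U i) (s i)].

(* P 0 is allowed: the empty space has the empty cover, so its invariants
   are 0. *)
Definition least_nat (P : nat -> Prop) : \bar R :=
  if pselect (exists n, `[< P n >]) is left exP then (ex_minn exP)%:R%:E
  else +oo%E.

Definition TC : \bar R := least_nat (sectional_cover (fun _ _ => True)).

Variables (G : topologicalGroupType) (a : gaction G X).

Definition equivariant_on (U : set (power X k))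
    (s : power X k -> path_space R X) :=
  forall g x, U x -> s (diagonal_act a g x) = path_act a g (s x).

(* TC_{k,G}^# *)
Definition TC_sharp : \bar R := least_nat (sectional_cover
  (fun U _ => invariant_under (diagonal_act a) U)).

(* TC_{k,G} *)
Definition TC_equiv : \bar R := least_nat (sectional_cover
  (fun U s => invariant_under (diagonal_act a) U /\ equivariant_on U s)).

(* TC_{k,G}^{#,*} *)
Definition TC_sharp_star : \bar R := least_nat (sectional_cover
  (fun U _ => invariant_under (componentwise_act a) U)).

(* TC_{k,G}^*; the sections are equivariant for the diagonal action only. *)
Definition TC_star : \bar R := least_nat (sectional_cover
  (fun U s => invariant_under (componentwise_act a) U /\ equivariant_on U s)).

End TopologicalComplexity.

(* Main.v *)
Require Import Defs.
From mathcomp Require Import all_boot all_order all_algebra.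
From mathcomp Require Import all_classical all_reals.
From mathcomp Require Import ereal topology normedtype.
From mathcomp Require Import lra.

Set Implicit Arguments.
Unset Strict Implicit.

Import Order.TTheory GRing.Theory Num.Theory.
Import numFieldNormedType.Exports.
Import ArrowAsCompactOpen.

(**
Every invariant in the statement is the least size of a cover of [X^k] by open
sets carrying sections and subject to some side condition.  Parts (2), (3) and
(4) are therefore comparisons of side conditions ([le_least_cover]): a set
invariant under [G^k] is invariant under the diagonal copy of [G]; for a
trivial action the strongest condition holds automatically; an action that
factors through another one has more invariant sets, which covers subgroups as
well as the diagonal of [G * G].

Part (1) is the only topological part.  The whole of [X^k] is invariant under
everything, so both invariants are 1 exactly when [X] is nonempty and
[endpoints] has a global continuous section ([contractible_least_cover]), and
this is equivalent to contractibility, in two steps.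

- Given a contraction [h] onto [x0] and points [x_0, ..., x_(k-1)], run along
  the contraction of [x_j] from [x0] to [x_j] and back to [x0] while the time
  stays within half a mesh of the [j]-th node.  Two neighbouring runs meet at
  [x0], so they glue to a map continuous in the points and the time
  ([closed_gluing]), which is then curried ([contractible_section]).

- Given a section, apply it to [(x, x0, ..., x0)].  Its value between the first
  two nodes moves [x] to [x0], and evaluation is jointly continuous because the
  unit interval is compact and regular ([section_contractible]).
*)

Local Open Scope classical_set_scope.
Local Open Scope ring_scope.

(** * Comparing least cover sizes *)

Lemma le_least_nat (R : realType) (P Q : nat -> Prop) :
  (forall n, Q n -> P n) -> (least_nat R P <= least_nat R Q)%E.
Proof.
move=> QP; rewrite /least_nat.
case: (pselect (exists n, `[< Q n >])) => [exQ|_]; last exact: leey.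
case: pselect => [exP|[]]; last first.
  by have [n /asboolP Qn] := exQ; exists n; apply/asboolP/QP.
rewrite lee_fin ler_nat; case: ex_minnP => m _ minm.
by apply: minm; case: ex_minnP => n /asboolP Qn _; apply/asboolP/QP.
Qed.

Lemma least_nat_eq1 (R : realType) (P : nat -> Prop) :
  least_nat R P = 1%E <-> P 1%N /\ ~ P 0%N.
Proof.
rewrite /least_nat; split=> [|[P1 P0]].
  case: pselect => // exP; case: ex_minnP => m /asboolP Pm minm [].
  move/eqP; rewrite pnatr_eq1 => /eqP m1; rewrite m1 in Pm minm.
  by split=> // P0; have := minm 0%N (asboolT P0).
case: pselect => [exP|[]]; last by exists 1%N; apply/asboolP.
case: ex_minnP => -[|[|m]] /asboolP Pm minm //.
by have := minm 1%N (asboolT P1).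
Qed.

Lemma le_least_cover (R : realType) (k : nat) (X : topologicalType)
    (C D : set (power X k) -> (power X k -> path_space R X) -> Prop) :
  (forall U s, D U s -> C U s) ->
  (least_nat R (sectional_cover C) <= least_nat R (sectional_cover D))%E.
Proof.
move=> DC; apply: le_least_nat => n [U [s [oU cU cs es Ds]]].
by exists U, s; split=> // i; exact: DC.
Qed.

Lemma componentwise_diagonal_invariant (k : nat) (G : topologicalGroupType)
    (X : topologicalType) (a : gaction G X) (U : set (power X k)) :
  invariant_under (componentwise_act a) U ->
  invariant_under (diagonal_act a) U.
Proof. by move=> inv g x Ux; exact: (inv (fun=> g)). Qed.

(** * Paths as maps on the unit interval *)

(** Near a point only the closed sets through that point matter, because the
finitely many others have open complements there; all the maps that do matter
take the same value at the point. *)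
Lemma closed_gluing (I : finType) (T W : topologicalType)
    (F : I -> set T) (f : I -> T -> W) :
  (forall i, closed (F i)) -> (forall p, exists i, F i p) ->
  (forall i, continuous (f i)) ->
  (forall i j p, F i p -> F j p -> f i p = f j p) ->
  exists2 g : T -> W, continuous g & forall i p, F i p -> g p = f i p.
Proof.
move=> clF /choice[c Fc] cf ff; exists (fun p => f (c p) p); last first.
  by move=> i p Fip; exact: ff.
move=> p V /= nV.
have : \forall q \near p, forall i, F i q -> V (f i q).
  apply: filter_forall => i; have [Fip|nFip] := pselect (F i p).
    have : nbhs p (f i @^-1` V) by apply: cf; rewrite (ff _ (c p)).
    by apply: filterS.
  have : nbhs p (~` F i).
    by apply: open_nbhs_nbhs; split => //; exact: closed_openC.
  by apply: filterS.
by apply: filterS => q; apply.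
Qed.

Section UnitInterval.
Variable R : realType.

Fact clamp_subproof (r : R) :
  Num.max 0 (Num.min 1 r) \in `[0 : R, 1]%classic.
Proof.
by rewrite inE /= in_itv /= le_max lexx ge_max ler01 ge_min lexx.
Qed.

(** A continuous retraction of the line onto the interval: it makes points of
[unit_interval R] out of real formulas without carrying bounds, and exhibits
the interval as the image of a compact set. *)
Definition clamp (r : R) : unit_interval R :=
  exist (fun t : R => t \in `[0 : R, 1]%classic) _ (clamp_subproof r).

Lemma val_clamp (r : R) : 0 <= r <= 1 -> val (clamp r) = r.
Proof. by case/andP=> r0 r1; rewrite /= min_r// max_r. Qed.

Lemma unit_interval_itv (t : unit_interval R) : 0 <= val t <= 1.
Proof. by case: t => t /=; rewrite inE /= in_itv. Qed.

Lemma clamp_val (t : unit_interval R) : clamp (val t) = t.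
Proof. exact/val_inj/val_clamp/unit_interval_itv. Qed.

Lemma val_continuous : continuous (val : unit_interval R -> R).
Proof. exact: (@initial_continuous _ R (val : unit_interval R -> R)). Qed.

Lemma clamp_continuous : continuous clamp.
Proof.
apply: (@continuous_comp_initial _ _ R (val : unit_interval R -> R)) => r.
apply: (@continuous_max R R (fun=> 0) (fun u => Num.min 1 u)).
  exact: cst_continuous.
by apply: (@continuous_min R R (fun=> 1) id); [exact: cst_continuous|].
Qed.

Lemma unit_interval_locally_compact : locally_compact [set: unit_interval R].
Proof.
move=> t _; exists setT; rewrite ?withinET; first exact: filterT.
split=> //; rewrite (_ : setT = clamp @` `[0, 1]); last first.
  apply/esym/seteqP; split=> // u _; exists (val u); last exact: clamp_val.
  by rewrite /= in_itv /= unit_interval_itv.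
apply: continuous_compact; last exact: segment_compact.
exact/continuous_subspaceT/clamp_continuous.
Qed.

(** Evaluation of compact-open paths is jointly continuous since the interval
is locally compact and regular. *)
Lemma path_eval_continuous (T X : topologicalType) (s : T -> path_space R X) :
  continuous s ->
  continuous (fun p : T * unit_interval R => s p.1 p.2).
Proof.
move=> cs; pose f x : unit_interval R -> X := s x.
rewrite (_ : (fun p => _) = uncurry f); last by apply/funext => -[].
apply: continuous_uncurry_regular.
- exact: unit_interval_locally_compact.
- exact: uniform_regular.
- apply: comp_continuous cs _.
  exact: (@initial_continuous _ {compact-open, unit_interval R -> X}
    (fun f : path_space R X => f : unit_interval R -> X)).
- move=> u; exact: (@cts_fun _ _ (s u : continuousType (unit_interval R) X)).
Qed.

Lemma path_curry (T X : topologicalType) (f : T * unit_interval R -> X) :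
  continuous f ->
  exists2 s : T -> path_space R X, continuous s & forall x t, s x t = f (x, t).
Proof.
move=> cf; have [cc cfx] := continuous_curry cf.
exists (fun x => mkcts (cfx x)) => //.
exact: (@continuous_comp_initial _ _ {compact-open, unit_interval R -> X}
  (fun f : path_space R X => f : unit_interval R -> X)).
Qed.

End UnitInterval.

(** * Contractibility and global sections *)

Lemma nearest_node (R : realType) (n : nat) (r : R) : 0 <= r <= n%:R ->
  exists i : 'I_n.+1, `|r - i%:R| <= 2^-1.
Proof.
case/andP=> r0 rn; have r20 : 0 <= r + 2^-1 by rewrite addr_ge0// invr_ge0.
have /andP[lo hi] := Num.Theory.truncn_itv r20; set j := Num.truncn _ in lo hi.
have jn : (j < n.+1)%N.
  rewrite -(ltr_nat R) -natr1; apply: le_lt_trans lo _.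
  by apply: ler_ltD => //; rewrite invf_lt1 ?ltr1n.
exists (Ordinal jn) => /=; rewrite -[j.+1%:R]natr1 in hi.
by rewrite ler_norml; apply/andP; split; lra.
Qed.

(** Distinct nodes are at distance at least 1, so the closed intervals of
radius [1/2] around them meet only in their endpoints. *)
Lemma node_tie (R : realType) (r : R) (i j : nat) : i != j ->
  `|r - i%:R| <= 2^-1 -> `|r - j%:R| <= 2^-1 -> `|r - i%:R| = 2^-1.
Proof.
move=> ij ri rj; have ij1 : 1 <= `|i%:R - j%:R : R|.
  wlog lt_ji : i j {ij ri rj} / (j < i)%N.
    by case: ltngtP ij => // lt _ /(_ _ _ lt); rewrite // distrC.
  by rewrite -natrB 1?ltnW// normr_nat ler1n subn_gt0.
have := ler_distD r i%:R (j%:R : R); rewrite [`|i%:R - r|]distrC; lra.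
Qed.

(** Around the node [i], at rescaled distance [d] from it, the path is at time
[2 d] of the contraction of [x i]: at [x i] on the node, and at the centre of
the contraction half a mesh away, where the next piece takes over. *)
Lemma contractible_section (R : realType) (k : nat) (X : topologicalType) :
  contractible R X ->
  exists2 s : power X k.+2 -> path_space R X,
    continuous s & forall x, endpoints (s x) = x.
Proof.
move=> [x0 [h [hc h01]]].
have h0 x t : val t = 0 -> h (x, t) = x by case: (h01 x t).
have h1 x t : val t = 1 -> h (x, t) = x0 by case: (h01 x t).
pose T := (power X k.+2 * unit_interval R)%type.
(* Distance to the node [i] in units of the mesh [1 / k.+1]. *)
pose d (i : 'I_k.+2) (p : T) : R := `|val p.2 * k.+1%:R - i%:R|.
have dc i : continuous (d i).
  apply: (comp_continuous (f := fun p : T => val p.2 * k.+1%:R - i%:R) _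
    (@norm_continuous R R^o)) => p.
  apply: (@cvgB R R^o); last exact: cvg_cst.
  apply: cvgM; last exact: cvg_cst.
  exact: (comp_continuous (@snd_continuous _ _) (@val_continuous R)).
pose f i (p : T) : X := h (p.1 i, clamp (2 * d i p)).
have [] := @closed_gluing _ T X (fun i => d i @^-1` [set r | r <= 2^-1]) f.
- by move=> i; apply: preimage_closed (@closed_le R 2^-1) => p _; exact: dc.
- move=> [x t]; rewrite /d /=; apply: nearest_node.
  have /andP[t0 t1] := unit_interval_itv t.
  by rewrite mulr_ge0//= ler_piMl.
- move=> i; apply: (continuous_comp2 hc).
    exact: (comp_continuous (g := fun x : power X k.+2 => x i)
      (@fst_continuous _ _) (@proj_continuous _ (fun=> X) i)).
  apply: comp_continuous (@clamp_continuous R) => p.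
  by apply: cvgM; [exact: cvg_cst|exact: dc].
- move=> i j p /= di dj; have [->//|] := eqVneq i j.
  rewrite -(inj_eq val_inj) => ij.
  have dE u : u = 2^-1 -> val (clamp (2 * u)) = 1.
    by move=> ->; rewrite mulfV// val_clamp// ler01 lexx.
  have ji : val j != val i by rewrite eq_sym.
  by rewrite /f !h1//; apply: dE; [exact: (node_tie ji)|exact: (node_tie ij)].
move=> g gc gE; have [s sc sE] := path_curry gc.
exists s => // x; apply/funext => i; rewrite /endpoints sE.
have d0 : d i (x, node R i) = 0.
  by rewrite /d /= divfK ?subrr ?normr0// pnatr_eq0.
by rewrite (gE i) /f /= d0 ?invr_ge0// h0// mulr0 val_clamp// lexx ler01.
Qed.

(** Freezing all the coordinates but the first at [x0], the section supplies a
path from [x] to [x0] depending continuously on [x]. *)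
Lemma section_contractible (R : realType) (k : nat) (X : topologicalType)
    (x0 : X) (s : power X k.+2 -> path_space R X) :
  continuous s -> (forall x, endpoints (s x) = x) -> contractible R X.
Proof.
move=> sc sE; pose pt (x : X) : power X k.+2 := dfwith (fun=> x0) ord0 x.
have ptc : continuous pt by exact: (@dfwith_continuous _ (fun=> X)).
(* The contraction runs through the first mesh only, up to the second node. *)
exists x0, (fun p => s (pt p.1) (clamp (val p.2 / k.+1%:R))); split.
  apply: (continuous_comp2 (path_eval_continuous sc)).
    exact: (comp_continuous (@fst_continuous _ _) ptc).
  apply: comp_continuous (@clamp_continuous R).
  move=> p; apply: cvgM; last exact: cvg_cst.
  exact: (comp_continuous (@snd_continuous _ _) (@val_continuous R)).
have clamp_node (i : 'I_k.+2) : clamp (i%:R / k.+1%:R) = node R i.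
  exact: (clamp_val (node R i)).
have ptE (x : X) i : s (pt x) (node R i) = pt x i.
  by rewrite -[in RHS](sE (pt x)).
move=> x t /=; split=> ->.
- by rewrite (clamp_node ord0) ptE /pt dfwithin.
- by rewrite (clamp_node (lift ord0 ord0)) ptE /pt dfwithout.
Qed.

(** A cover of size 1 consists of the whole power, so it is a global section.
Nonemptiness of [X] is what separates the value 1 from the value 0. *)
Lemma contractible_least_cover (R : realType) (k : nat) (X : topologicalType)
    (C : set (power X k.+2) -> (power X k.+2 -> path_space R X) -> Prop) :
  (forall s, C setT s) ->
  contractible R X <-> least_nat R (sectional_cover C) = 1%E.
Proof.
move=> CT; rewrite least_nat_eq1; split=> [cX|].
  split.
    have [s sc sE] := @contractible_section R k X cX.
    exists (fun=> setT), (fun=> s); split=> // [i||].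
    - exact: openT.
    - by apply/seteqP; split=> // x _; exists ord0.
    - by move=> _; exact/continuous_subspaceT.
  move=> [U [s [_ cU _ _ _]]]; have [x0 _] := cX.
  by have : setT ((fun=> x0) : power X k.+2) by []; rewrite -cU => -[[]].
move=> [[U [s [_ cU sc sE _]]] n0].
have UT : U ord0 = setT.
  by apply/seteqP; split=> // x; rewrite -cU => -[i _]; rewrite (ord1 i).
(* On an empty [X] the power would be empty too, hence covered by no set. *)
have [x0] : exists x0 : X, True.
  apply: contrapT => nX; apply: n0; exists (fun=> setT), (fun=> s ord0).
  split; try by case.
  by apply/seteqP; split=> // x _; case: nX; exists (x ord0).
move=> _; apply: (@section_contractible R k X x0 (s ord0)).
  by apply/continuous_subspace_setT; rewrite -UT.
by move=> x; apply: sE; rewrite UT.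
Qed.

Unset Implicit Arguments.
Set Strict Implicit.

Local Open Scope ereal_scope.

Theorem proposition3p26 (R : realType) (k : nat) (k2 : (2 <= k)%N)
    (G : topologicalGroupType) (X : topologicalType) (a : gaction G X) :
  [/\
    contractible R X <->
      (TC_sharp R k a = TC_sharp_star R k a /\ TC_sharp_star R k a = 1),
    (TC_sharp R k a <= TC_equiv R k a /\ TC_equiv R k a <= TC_star R k a) /\
    [/\ TC R k X <= TC_sharp R k a,
        TC_sharp R k a <= TC_sharp_star R k a &
        TC_sharp_star R k a <= TC_star R k a],
    trivial_action a ->
      [/\ TC R k X = TC_equiv R k a,
          TC_equiv R k a = TC_sharp R k a,
          TC_sharp R k a = TC_sharp_star R k a &
          TC_sharp_star R k a = TC_star R k a] &
    (forall H : subgroup G,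
      TC_sharp R k (gaction_restrict a H) <= TC_sharp R k a /\
      TC_sharp_star R k (gaction_restrict a H) <= TC_sharp_star R k a) /\
    (forall (Y : topologicalType) (b : gaction G Y),
      TC_sharp R k (gaction_diag a b) <= TC_sharp R k (gaction_prod a b) /\
      TC_sharp_star R k (gaction_diag a b) <=
        TC_sharp_star R k (gaction_prod a b))].
Proof.
have contractible_iff : contractible R X <->
    (TC_sharp R k a = TC_sharp_star R k a /\ TC_sharp_star R k a = 1).
  case: k k2 => [//|[//|m]] _.
  have sharp1 : contractible R X <-> TC_sharp R m.+2 a = 1.
    exact: contractible_least_cover.
  have sharp_star1 : contractible R X <-> TC_sharp_star R m.+2 a = 1.
    exact: contractible_least_cover.
  split=> [cX|[_ /sharp_star1//]].
  by rewrite (sharp1.1 cX) (sharp_star1.1 cX).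
have cd := @componentwise_diagonal_invariant k G X a.
have le_sharp_equiv : TC_sharp R k a <= TC_equiv R k a.
  by apply: le_least_cover => U s [].
have le_equiv_star : TC_equiv R k a <= TC_star R k a.
  by apply: le_least_cover => U s [/cd].
have le_TC_sharp : TC R k X <= TC_sharp R k a by exact: le_least_cover.
have le_sharp_sharp_star : TC_sharp R k a <= TC_sharp_star R k a.
  by apply: le_least_cover => U s /cd.
have le_sharp_star_star : TC_sharp_star R k a <= TC_star R k a.
  by apply: le_least_cover => U s [].
split=> //.
- move=> ta.
  have le_star_TC : TC_star R k a <= TC R k X.
    apply: le_least_cover => U s _; split=> [g x Ux|g x Ux].
      by rewrite (_ : componentwise_act _ _ _ = x)//; apply/funext => i; exact: ta.
    rewrite (_ : diagonal_act a g x = x); last by apply/funext => i; exact: ta.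
    by apply/continuousEP => t; exact/esym/ta.
  have le_TC_star : TC R k X <= TC_star R k a.
    exact: le_trans le_TC_sharp (le_trans le_sharp_equiv le_equiv_star).
  have eq_TC u : TC R k X <= u -> u <= TC_star R k a -> u = TC R k X.
    by move=> lu ul; apply/le_anti; rewrite lu (le_trans ul).
  rewrite (eq_TC (TC_equiv R k a))// ?(le_trans le_TC_sharp)//.
  rewrite (eq_TC (TC_sharp R k a))// ?(le_trans le_sharp_equiv)//.
  rewrite (eq_TC (TC_sharp_star R k a))// ?(le_trans le_TC_sharp)//.
  by rewrite (eq_TC (TC_star R k a)).
- split=> [H|Y b]; split; apply: le_least_cover => U _ inv g x Ux.
  + exact: (inv (val g)).
  + exact: (inv (fun i => val (g i))).
  + exact: (inv (g, g)).
  + exact: (inv (fun i => (g i, g i))).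
Qed.
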